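(* Let $\mathcal{H}$ be a real Hilbert space, $Q\subset\mathcal{H}$ a nonempty, closed and convex subset, $S:Q\to Q$ a nonexpansive mapping, $A:Q\to\mathcal{H}$ a $\nu$-inverse strongly monotone operator with $\nu>0$, and $f:Q\to Q$ a contraction with coefficient $\rho\in[0,1[$. Assume that $\Omega:=F_{ix}(S)\cap S_{VI(A,Q)}$ is nonempty. Let $\{\alpha_n\}_{n\ge0}\subset]0,1]$ and $\{\lambda_n\}_{n\ge0}\subset[0,2\nu]$ be two real sequences such that: (i) $\alpha_n\to0$ and $\sum_{n=0}^{+\infty}\alpha_n=+\infty$; (ii) $0<\liminf_{n\to+\infty}\lambda_n\le\limsup_{n\to+\infty}\lambda_n<2\nu$; (iii) $\frac{\alpha_{n+1}-\alpha_n}{\alpha_n}\to0$ or $\sum_{n=0}^{+\infty}|\alpha_{n+1}-\alpha_n|<\infty$; (iv) $\frac{\lambda_{n+1}-\lambda_n}{\alpha_n}\to0$ or $\sum_{n=0}^{+\infty}|\lambda_{n+1}-\lambda_n|<\infty$. Then for every initial data $x_1\in Q$, the sequence $\{x_n\}$ generated by the iterative process $$x_{n+1}=\alpha_nf(x_n)+(1-\alpha_n)SP_Q(x_n-\lambda_nAx_n),\quad n\ge1,$$ converges strongly in $\mathcal{H}$ to $q^*$, the unique solution of the variational problem (VP): $q^*\in\Omega$ and $\langle f(q^* )-q^*,x-q^*\rangle\le0$ for all $x\in\Omega$.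
   Context: $\mathcal{H}$ has inner product $\langle\cdot,\cdot\rangle$ and associated norm $\|\cdot\|$. Nonexpansive: $\|Sx-Sy\|\le\|x-y\|$ for all $x,y\in Q$. $\nu$-inverse strongly monotone: $\langle Ax-Ay,x-y\rangle\ge\nu\|Ax-Ay\|^2$ for all $x,y\in Q$. Contraction with coefficient $\rho$: $\|f(x)-f(y)\|\le\rho\|x-y\|$ for all $x,y\in Q$. $F_{ix}(S)=\{x\in Q: Sx=x\}$. $S_{VI(A,Q)}=\{q\in Q:\langle Aq,x-q\rangle\ge0\ \text{for every }x\in Q\}$. $P_Q:\mathcal{H}\to Q$ is the metric projection onto $Q$. Intervals: $]0,1]$ and $[0,1[$ are half-open. *)

(* Defs.v *)
From HB Require Import structures.
From mathcomp Require Import all_boot all_order all_algebra.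
From mathcomp Require Import all_classical all_reals all_analysis.
Import Order.TTheory GRing.Theory Num.Theory.
Import numFieldNormedType.Exports.

Set Implicit Arguments.
Unset Strict Implicit.
Unset Printing Implicit Defensive.

Local Open Scope classical_set_scope.
Local Open Scope ring_scope.

(* A real Hilbert space is a complete normed module whose norm is the one
   associated with a positive definite symmetric bilinear form. *)
Definition norm_of_dot (R : realType) (H : normedModType R)
    (dot : {dot H for (idfun : R -> R)}) : Prop :=
  forall x : H, `|x| = Num.sqrt (dot x x).

(* Mappings defined on a subset Q are represented by functions on the whole
   space; only their values on Q enter the definitions below. *)
Definition inverse_strongly_monotone (R : realType) (H : normedModType R)
    (dot : {dot H for (idfun : R -> R)}) (Q : set H) (nu : R) (A : H -> H)
    : Prop :=
  forall x y, Q x -> Q y ->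
    nu * `|A x - A y| ^+ 2 <= dot (A x - A y) (x - y).

Definition fix_set (H : Type) (Q : set H) (S : H -> H) : set H :=
  [set x | Q x /\ S x = x].

Definition vi_set (R : realType) (H : normedModType R)
    (dot : {dot H for (idfun : R -> R)}) (Q : set H) (A : H -> H) : set H :=
  [set q | Q q /\ forall x, Q x -> 0 <= dot (A q) (x - q)].

(* The point of Q nearest to x. When Q is a nonempty closed convex subset of
   a Hilbert space there is exactly one such point; the default value 0 is
   returned only if there is none. *)
Definition metric_proj (R : realType) (H : normedModType R) (Q : set H)
    (x : H) : H :=
  xget 0 [set p | Q p /\ forall y, Q y -> `|x - p| <= `|x - y|].

Definition vp_solution (R : realType) (H : normedModType R)
    (dot : {dot H for (idfun : R -> R)}) (Omega : set H) (f : H -> H)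
    : set H :=
  [set q | Omega q /\ forall x, Omega x -> dot (f q - q) (x - q) <= 0].

(* Main.v *)
Require Import Defs.
From HB Require Import structures.
From mathcomp Require Import all_boot all_order all_algebra.
From mathcomp Require Import all_classical all_reals all_analysis.
From mathcomp Require Import ring lra.
Import Order.TTheory GRing.Theory Num.Theory.
Import numFieldNormedType.Exports.

Set Implicit Arguments.
Unset Strict Implicit.
Unset Printing Implicit Defensive.

Local Open Scope classical_set_scope.
Local Open Scope ring_scope.

(** The proof needs no weak topology. Three ideas carry it.

    First, the constraint set is the solution set of a single variational
    inequality. Since [A] is inverse strongly monotone and [I - S] is too (with
    constant 1/2), the set [Fix S] of fixed points intersected with the
    solutions of the inequality for [A] is, as soon as it is nonempty, the
    solution set of the inequality for the monotone Lipschitz operator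
    [B = A + (I - S)] ([fix_vi_setE]). By Minty's lemma ([minty]) this set is
    cut out of [Q] by the linear inequalities [<B w, z - w> <= 0], one for each
    [w] in [Q]. It is therefore closed and convex, and [q] is the fixed point
    of the contraction which composes [f] with the projection onto it
    ([exists_vp_solution]).

    Secondly, the linearity of Minty's inequalities replaces weak sequential
    compactness. If [x_n] is bounded and [<B x_n, x_n - w>] is at most
    [eps_n (1 + |w|)] with [eps_n] tending to 0, then the sets of points of [Q]
    that satisfy Minty's inequalities up to an error [1/(k+1)] and lie in a
    fixed half-space met infinitely often by [x_n] form a decreasing sequence
    of nonempty bounded closed convex sets. Such a sequence has a common point
    ([nested_closed_convex], by the parallelogram identity), and this point
    solves the variational inequality. Hence the upper limit of
    [<f q - q, x_n - q>] is at most 0 ([vi_demiclosed]).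

    Thirdly, the iterates satisfy the hypotheses of the second step, by
    estimates that all rest on the recursion
    [s_(n+1) <= (1 - gamma_n) s_n + gamma_n delta_n + beta_n]
    ([recursive_ineq_cvg0]). Applied to the norms of the increments it gives
    asymptotic regularity. The firm nonexpansiveness of the projection turns
    this into [|x_n - y_n| -> 0] ([forward_backward_gap]), where [y_n] is the
    projected point, and then [|x_n - S x_n| -> 0]. Applied to the numbers
    [|x_n - q|^2] the same recursion gives the convergence ([iterate_cvg]). *)

(** * Inner products and norms *)

Section InnerProduct.
Variables (R : realType) (H : normedModType R).
Variables (dot : {dot H for (idfun : R -> R)}) (Hdot : norm_of_dot dot).
Implicit Types x y z : H.

Lemma dotC x y : dot x y = dot y x.
Proof. by rewrite hermC /= expr0 mul1r. Qed.

Lemma dotDl x y z : dot (x + y) z = dot x z + dot y z.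
Proof. exact: linearDl. Qed.

Lemma dotDr x y z : dot x (y + z) = dot x y + dot x z.
Proof. exact: linearDr. Qed.

Lemma dotZl a x y : dot (a *: x) y = a * dot x y.
Proof. by rewrite linearZl_LR. Qed.

Lemma dotZr a x y : dot x (a *: y) = a * dot x y.
Proof. by rewrite dotC dotZl dotC. Qed.

Lemma dotNl x y : dot (- x) y = - dot x y.
Proof. exact: linearNl. Qed.

Lemma dotNr x y : dot x (- y) = - dot x y.
Proof. exact: linearNr. Qed.

Lemma dotxx x : dot x x = `|x| ^+ 2.
Proof.
rewrite Hdot sqr_sqrtr//; have [->|x0] := eqVneq x 0.
  by rewrite (linear0l dot).
exact: ltW (neq0_dnorm_gt0 _ x0).
Qed.

Lemma sqnormD x y : `|x + y| ^+ 2 = `|x| ^+ 2 + 2 * dot x y + `|y| ^+ 2.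
Proof. rewrite -!dotxx !(dotDl, dotDr) (dotC y x); ring. Qed.

Lemma sqnormB x y : `|x - y| ^+ 2 = `|x| ^+ 2 - 2 * dot x y + `|y| ^+ 2.
Proof. by rewrite sqnormD dotNr normrN mulrN. Qed.

(** Cauchy-Schwarz, from the squared norm of the vector |y| x - |x| y. *)
Lemma dot_le_norm x y : dot x y <= `|x| * `|y|.
Proof.
have [->|y0] := eqVneq y 0; first by rewrite (linear0r dot) normr0 mulr0.
have ny : 0 < `|y| by rewrite normr_gt0.
have := sqr_ge0 `| `|y| *: x - `|x| *: y|.
rewrite sqnormB dotZl dotZr !normrZ !normr_id.
have [->|x0] := eqVneq x 0; first by rewrite (linear0l dot) normr0 mul0r.
have nx : 0 < `|x| by rewrite normr_gt0.
move=> h; have : 0 <= `|y| * `|x| * (`|x| * `|y| - dot x y) by nra.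
by rewrite pmulr_rge0 ?mulr_gt0// subr_ge0.
Qed.

End InnerProduct.

Definition dotE := (dotDl, dotDr, dotNl, dotNr, dotZl, dotZr).

(** * Closed convex sets *)

(** Midpoints are all that the parallelogram identity asks for, and this form
    of convexity is immediate to check for intersections of half-spaces and
    balls. *)
Definition midpoint_convex (R : realType) (H : lmodType R) (K : set H) : Prop :=
  forall x y, K x -> K y -> K (2^-1 *: (x + y)).

Lemma convex_set_comb (R : realType) (H : lmodType R) (Q : set H) (x y : H)
    (t : R) :
  convex_set Q -> Q x -> Q y -> 0 <= t <= 1 -> Q (t *: x + (1 - t) *: y).
Proof.
move=> cQ Qx Qy /andP[t0 t1].
by have := cQ x y (Itv01 t0 t1) (mem_set Qx) (mem_set Qy); rewrite inE.
Qed.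

Lemma convex_set_segment (R : realType) (H : lmodType R) (Q : set H) (x y : H)
    (t : R) :
  convex_set Q -> Q x -> Q y -> 0 <= t <= 1 -> Q (x + t *: (y - x)).
Proof.
move=> cQ Qx Qy t01; have -> : x + t *: (y - x) = t *: y + (1 - t) *: x.
  by rewrite scalerBl scale1r scalerBr addrCA.
exact: convex_set_comb.
Qed.

Lemma convex_set_midpoint (R : realType) (H : lmodType R) (Q : set H) :
  convex_set Q -> midpoint_convex Q.
Proof.
move=> cQ x y Qx Qy.
have half : 0 <= (2^-1 : R) <= 1 by apply/andP; split; lra.
have -> : 2^-1 *: (x + y) = 2^-1 *: x + (1 - 2^-1) *: y.
  by rewrite scalerDr; congr (_ + _ *: _); field.
exact: convex_set_comb.
Qed.

Lemma invS_near (R : realType) (e : R) : 0 < e ->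
  \forall n \near \oo, n.+1%:R^-1 <= e.
Proof.
by move=> e0; apply: filterS (near_infty_natSinv_lt (PosNum e0)) => n /ltW.
Qed.

Section Nested.
Variables (R : realType) (H : completeNormedModType R).
Variables (dot : {dot H for (idfun : R -> R)}) (Hdot : norm_of_dot dot).

Lemma parallelogram (x y : H) :
  `|x - y| ^+ 2 = 2 * `|x| ^+ 2 + 2 * `|y| ^+ 2 - 4 * `|2^-1 *: (x + y)| ^+ 2.
Proof.
rewrite normrZ exprMn normfV ger0_norm// (sqnormB Hdot) (sqnormD Hdot); by field.
Qed.

(** The distances of the sets to the origin increase and are bounded, so they
    converge. Almost nearest points then form a Cauchy sequence: the midpoint of
    two of them lies in the larger set, so it is not much shorter than either,
    and the parallelogram identity bounds the distance between the two. This
    is the substitute for weak compactness. *)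
Lemma nested_closed_convex (K : nat -> set H) (M : R) :
  (forall n, closed (K n)) -> (forall n, midpoint_convex (K n)) ->
  (forall n, K n !=set0) -> (forall n, K n.+1 `<=` K n) ->
  (forall n x, K n x -> `|x| <= M) ->
  exists x, forall n, K n x.
Proof.
move=> Kcl Kconv K0 Ksub KM.
have Kle n m : (n <= m)%N -> K m `<=` K n.
  by move/subnK <-; elim: (m - n)%N => // k IH x /Ksub /IH.
pose N n := [set `|y| | y in K n].
pose d n := inf (N n).
have Ninf n : has_inf (N n).
  split; first by have [y Ky] := K0 n; exists `|y|; exists y.
  by exists 0 => _ [y _ <-].
have dle n y : K n y -> d n <= `|y|.
  by move=> Ky; apply: ge_inf; [exact: (Ninf n).2|exists y].
have d0 n : 0 <= d n by apply: lb_le_inf; [exact: (Ninf n).1|move=> _ [y _ <-]].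
have dM n : d n <= M.
  by have [y Ky] := K0 n; apply: le_trans (dle _ _ Ky) (KM _ _ Ky).
have dmono : nondecreasing_seq d.
  move=> n m nm; apply: lb_le_inf; first exact: (Ninf m).1.
  by move=> _ [y Ky <-]; apply: dle; exact: Kle Ky.
have [D dD] : exists D, d @ \oo --> (D : R).
  apply/cvg_ex/nondecreasing_is_cvgn => //; exists M => _ [n _ <-]; exact: dM.
have dleD n : d n <= D.
  have <- : limn d = D by exact: cvg_lim.
  by apply: nondecreasing_cvgn_le => //; apply/cvg_ex; exists D.
have xP n : exists x, K n x /\ `|x| <= d n + n.+1%:R^-1.
  have [_ [y Ky <-] yd] := @inf_adherent _ (N n) n.+1%:R^-1 ltac:(by []) (Ninf n).
  by exists y; split => //; exact: ltW.
have [x {}xP] := choice xP.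
(* the parallelogram bound for |x n - x m|^2 when n <= m: both norms are at
   most D + 1/(n+1), and the midpoint has norm at least d n *)
pose e n := 4 * (D + n.+1%:R^-1) ^+ 2 - 4 * d n ^+ 2.
have xe n m : (n <= m)%N -> `|x n - x m| ^+ 2 <= e n.
  move=> nm; have [Kn xn] := xP n; have [Km xm] := xP m.
  have mid : d n <= `|2^-1 *: (x n + x m)|.
    by apply: dle; apply: Kconv => //; exact: Kle Km.
  have inv : m.+1%:R^-1 <= n.+1%:R^-1 :> R by rewrite lef_pV2 ?posrE// ler_nat.
  have xn2 : `|x n| ^+ 2 <= (D + n.+1%:R^-1) ^+ 2.
    by rewrite ler_sqr ?nnegrE ?addr_ge0// ?(le_trans xn) ?lerD// (le_trans (d0 n)).
  have xm2 : `|x m| ^+ 2 <= (D + n.+1%:R^-1) ^+ 2.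
    by rewrite ler_sqr ?nnegrE ?addr_ge0// ?(le_trans xm) ?lerD// (le_trans (d0 n)).
  have mid2 : d n ^+ 2 <= `|2^-1 *: (x n + x m)| ^+ 2 by rewrite ler_sqr ?nnegrE.
  rewrite parallelogram /e; move: xn2 xm2 mid2.
  set p := `|x n| ^+ 2; set q := `|x m| ^+ 2; set r := `|_| ^+ 2.
  set s := (_ + _) ^+ 2; set t := d n ^+ 2; lra.
have e0 : e @ \oo --> (0 : R).
  have -> : 0 = 4 * ((D + 0) * (D + 0)) - 4 * (D * D) :> R by ring.
  have Dn : D + n.+1%:R^-1 @[n --> \oo] --> D + 0.
    by apply: cvgD; [exact: cvg_cst|exact: cvg_harmonic].
  by apply: cvgB; apply: cvgM; try exact: cvg_cst; apply: cvgM.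
have xcv : cvgn x.
  apply/cauchy_cvgP/cauchy_exP => r r0.
  have : \forall n \near \oo, e n < r ^+ 2.
    by apply: cvgr_lt e0 _ _; rewrite exprn_gt0.
  case=> N0 _ HN; exists (x N0); exists N0 => // k /= Nk.
  rewrite -ball_normE /= -ltr_sqr ?nnegrE// ?ltW//.
  by apply: le_lt_trans (xe _ _ Nk) _; apply: HN => /=.
have /cvg_ex[z xz] := xcv; exists z => n.
apply: (closed_cvg _ (Kcl n) _ _ xz); exists n => // m /= nm.
by apply: Kle nm _ _; exact: (xP m).1.
Qed.

End Nested.

Section HalfSpaces.
Variables (R : realType) (H : normedModType R).
Variables (dot : {dot H for (idfun : R -> R)}) (Hdot : norm_of_dot dot).

Lemma dot_continuous (v : H) : continuous (dot v).
Proof.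
move=> x; apply/cvgrPdist_lt => e e0; near=> y.
have v0 : 0 < `|v| + 1 by rewrite ltr_pwDr.
have xy : `|x - y| < e / (`|v| + 1).
  by near: y; apply: cvgr_dist_lt; rewrite ?divr_gt0.
rewrite -(linearBr dot); apply: le_lt_trans (_ : `|v| * `|x - y| < e).
  rewrite ler_norml dot_le_norm// andbT lerNl -dotNr -(normrN (x - y)).
  exact: dot_le_norm.
rewrite ltr_pdivlMr// in xy; apply: le_lt_trans xy; rewrite mulrC.
by rewrite ler_wpM2l// lerDl.
Unshelve. all: by end_near. Qed.

Lemma closed_half_space (v : H) (c : R) : closed [set z | dot v z <= c].
Proof.
apply: (@preimage_closed _ _ (dot v) [set z : R | z <= c]); last exact: closed_le.
by move=> x _; exact: dot_continuous.
Qed.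

End HalfSpaces.

Lemma midpoint_convex_half_space (R : realType) (H : normedModType R)
    (dot : {dot H for (idfun : R -> R)}) (v : H) (c : R) :
  midpoint_convex [set z | dot v z <= c].
Proof. by move=> x y /= xc yc; rewrite dotZr dotDr; lra. Qed.

Lemma midpoint_convex_closed_ball (R : realType) (H : normedModType R) (u : H)
    (r : R) :
  midpoint_convex (closed_ball_ Num.norm u r).
Proof.
move=> x y; rewrite /closed_ball_ /= => xr yr.
have -> : u - 2^-1 *: (x + y) = 2^-1 *: ((u - x) + (u - y)).
  rewrite addrACA -opprD scalerBr; congr (_ - _).
  rewrite -[u in LHS]scale1r -[in RHS](scale1r u) -scalerDl scalerA.
  by congr (_ *: _); field.
rewrite normrZ normfV ger0_norm// mulrC ler_pdivrMr//.
by apply: le_trans (ler_normD _ _) _; rewrite mulr_natr mulr2n lerD.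
Qed.

Lemma midpoint_convexI (R : realType) (H : lmodType R) (K L : set H) :
  midpoint_convex K -> midpoint_convex L -> midpoint_convex (K `&` L).
Proof. by move=> cK cL x y [? ?] [? ?]; split; [exact: cK|exact: cL]. Qed.

Lemma midpoint_convex_bigcap (R : realType) (H : lmodType R) (I : Type)
    (D : set I) (K : I -> set H) :
  (forall i, midpoint_convex (K i)) -> midpoint_convex (\bigcap_(i in D) K i).
Proof. by move=> cK x y Kx Ky i Di; apply: cK; [exact: Kx|exact: Ky]. Qed.

(** * Metric projection *)

(** The relation computed by [metric_proj]; the properties of nearest points do
    not depend on completeness, which only serves for their existence. *)
Definition nearest (R : realType) (H : normedModType R) (Q : set H)
    (x p : H) : Prop :=
  Q p /\ forall y, Q y -> `|x - p| <= `|x - y|.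

(** First-order conditions are obtained by moving a distance t along a segment,
    dividing by t and letting t tend to 0; this is the limit step. *)
Lemma le0_le_scale (R : realType) (a b : R) :
  (forall t, 0 < t <= 1 -> a <= t * b) -> a <= 0.
Proof.
move=> h; rewrite leNgt; apply/negP => a0.
have ab : a <= b by rewrite -[b]mul1r h// ltr01 lexx.
have b0 : 0 < b by exact: lt_le_trans ab.
have : a <= a / (2 * b) * b.
  apply: h; rewrite divr_gt0 ?mulr_gt0//= ler_pdivrMr ?mulr_gt0//; lra.
have -> : a / (2 * b) * b = a / 2 by field; rewrite gt_eqF.
lra.
Qed.

Section Projection.
Variables (R : realType) (H : normedModType R).
Variables (dot : {dot H for (idfun : R -> R)}) (Hdot : norm_of_dot dot).
Variables (Q : set H) (Q_convex : convex_set Q).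

(** The variational characterization of the projection: otherwise a short step
    from p towards y would bring it closer to x. *)
Lemma nearest_obtuse (x p y : H) :
  nearest Q x p -> Q y -> dot (x - p) (y - p) <= 0.
Proof.
move=> [Qp px] Qy.
apply: (@le0_le_scale _ _ (2^-1 * `|y - p| ^+ 2)) => t /andP[t0 t1].
have Qt : Q (p + t *: (y - p)).
  by apply: convex_set_segment => //; rewrite ltW.
have := px _ Qt; rewrite -ler_sqr ?nnegrE// opprD addrA (sqnormB Hdot (x - p)).
rewrite dotZr normrZ exprMn (ger0_norm (ltW t0)).
set a := dot _ _; set b := `|y - p| ^+ 2; set c := `|x - p| ^+ 2 => h.
have : t * (2 * a) <= t * (t * b) by nra.
by rewrite ler_pM2l//; lra.
Qed.

(** Firm nonexpansiveness: the sum of the two obtuse angle conditions. *)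
Lemma nearest_firm (x x' p p' : H) :
  nearest Q x p -> nearest Q x' p' ->
  `|p - p'| ^+ 2 <= dot (x - x') (p - p').
Proof.
move=> np np'; have := nearest_obtuse np np'.1; have := nearest_obtuse np' np.1.
rewrite -(dotxx Hdot) !dotE (dotC dot p' p); lra.
Qed.

Lemma nearest_nonexpansive (x x' p p' : H) :
  nearest Q x p -> nearest Q x' p' -> `|p - p'| <= `|x - x'|.
Proof.
move=> np np'; have := nearest_firm np np'.
have [->|pp] := eqVneq (p - p') 0; first by rewrite normr0.
have := dot_le_norm Hdot (x - x') (p - p') => /[swap] /le_trans /[apply].
by rewrite expr2 ler_pM2r// normr_gt0.
Qed.

Lemma nearestP (x p : H) :
  Q p -> (forall y, Q y -> dot (x - p) (y - p) <= 0) -> nearest Q x p.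
Proof.
move=> Qp h; split => // y Qy; rewrite -ler_sqr ?nnegrE//.
have -> : x - y = (x - p) - (y - p) by rewrite opprB addrA subrK.
rewrite (sqnormB Hdot (x - p)); have := h _ Qy.
have := sqr_ge0 `|y - p|; lra.
Qed.

End Projection.

Section Existence.
Variables (R : realType) (H : completeNormedModType R).
Variables (dot : {dot H for (idfun : R -> R)}) (Hdot : norm_of_dot dot).

(** The intersections of Q with balls around x whose radii decrease to the
    distance from x to Q are nested closed convex sets. *)
Lemma exists_nearest (Q : set H) (x : H) :
  Q !=set0 -> closed Q -> convex_set Q -> exists p, nearest Q x p.
Proof.
move=> Q0 Qcl Qcv; pose N := [set `|x - y| | y in Q]; pose d := inf N.
have Ninf : has_inf N.
  split; first by have [y Qy] := Q0; exists `|x - y|; exists y.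
  by exists 0 => _ [y _ <-].
have dle y : Q y -> d <= `|x - y|.
  by move=> Qy; apply: ge_inf; [exact: Ninf.2|exists y].
pose K n := Q `&` closed_ball_ Num.norm x (d + n.+1%:R^-1).
have [p Kp] : exists p, forall n, K n p.
  apply: (nested_closed_convex Hdot (M := `|x| + (d + 1))).
  - by move=> n; apply: closedI => //; exact: closed_closed_ball_.
  - move=> n; apply: midpoint_convexI; first exact: convex_set_midpoint.
    exact: midpoint_convex_closed_ball.
  - move=> n; have [_ [y Qy <-] yd] := @inf_adherent _ N n.+1%:R^-1 ltac:(by []) Ninf.
    by exists y; split => //; rewrite /closed_ball_ /= ltW.
  - move=> n y [Qy]; rewrite /closed_ball_ /= => xy; split => //=.
    by apply: le_trans xy _; rewrite lerD2l lef_pV2 ?posrE// ler_nat.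
  - move=> n y [Qy]; rewrite /closed_ball_ /= => xy.
    have -> : y = x - (x - y) by rewrite opprB addrC subrK.
    apply: le_trans (ler_normB _ _) _; rewrite lerD2l (le_trans xy)// lerD2l.
    by rewrite invf_le1// ler1n.
exists p; split; first by have [] := Kp 0%N.
move=> y Qy; apply: le_trans (dle _ Qy).
apply/ler_addgt0Pr => e e0; have [n _ /(_ n)] := invS_near e0.
move=> /(_ (leqnn n)) /= ne; have [_] := Kp n; rewrite /closed_ball_ /=.
by move=> /le_trans; apply; rewrite lerD2l.
Qed.

Lemma metric_projP (Q : set H) (x : H) :
  Q !=set0 -> closed Q -> convex_set Q -> nearest Q x (metric_proj Q x).
Proof.
move=> Q0 Qcl Qcv; exact: (xgetPex 0 (exists_nearest x Q0 Qcl Qcv)).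
Qed.

End Existence.

(** * Variational inequalities of monotone operators *)

Section Monotone.
Variables (R : realType) (H : normedModType R).
Variables (dot : {dot H for (idfun : R -> R)}) (Hdot : norm_of_dot dot).
Variables (Q : set H) (Q_convex : convex_set Q).
Variables (B : H -> H) (L : R).
Hypothesis B_monotone :
  forall x y, Q x -> Q y -> 0 <= dot (B x - B y) (x - y).
Hypothesis B_lipschitz :
  forall x y, Q x -> Q y -> `|B x - B y| <= L * `|x - y|.

(** Monotonicity gives one direction. For the other, test the inequality at a
    point at distance t from z on the segment towards w and let t tend to 0;
    the Lipschitz bound controls the change in B. The gain is that
    the right-hand side is linear in z. *)
Lemma minty (z : H) :
  vi_set dot Q B z <-> Q z /\ forall w, Q w -> dot (B w) (z - w) <= 0.
Proof.
split=> [[Qz viz]|[Qz mz]]; split=> // w Qw.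
  have := viz _ Qw; have := B_monotone Qw Qz.
  rewrite !dotE; lra.
rewrite -oppr_le0; apply: (@le0_le_scale _ _ (L * `|w - z| ^+ 2)) => t.
move=> /andP[t0 t1].
have Qt : Q (z + t *: (w - z)) by apply: convex_set_segment => //; rewrite ltW.
set wt := z + _ in Qt *.
have twz : z - wt = - (t *: (w - z)) by rewrite opprD addrA subrr add0r.
have : 0 <= dot (B wt) (w - z).
  by have := mz _ Qt; rewrite twz !dotE oppr_le0 pmulr_rge0.
have := dot_le_norm Hdot (B wt - B z) (w - z).
have := B_lipschitz Qt Qz; have -> : wt - z = t *: (w - z) by rewrite addrC addKr.
rewrite normrZ (ger0_norm (ltW t0)) dotDl dotNl.
have := normr_ge0 (w - z).
set a := `|w - z|; set b := `|B wt - B z|; set c := dot _ _; set d := dot _ _.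
move=> a0 bL; have : b * a <= L * (t * a) * a by rewrite ler_wpM2r.
rewrite expr2; lra.
Qed.

Lemma vi_setE :
  vi_set dot Q B = Q `&` \bigcap_(w in Q) [set z | dot (B w) z <= dot (B w) w].
Proof.
apply/seteqP; split=> z.
  move=> /minty[Qz mz]; split => // w Qw /=; have := mz _ Qw.
  by rewrite dotDr dotNr; lra.
move=> [Qz mz]; apply/minty; split => // w Qw; have /= := mz _ Qw.
by rewrite dotDr dotNr; lra.
Qed.

Lemma closed_vi_set : closed Q -> closed (vi_set dot Q B).
Proof.
move=> Qcl; rewrite vi_setE; apply: closedI => //.
by apply: closed_bigI => w _; exact: closed_half_space.
Qed.

End Monotone.

Lemma convex_vi_set (R : realType) (H : normedModType R)
    (dot : {dot H for (idfun : R -> R)}) (Hdot : norm_of_dot dot)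
    (Q : set H) (Q_convex : convex_set Q) (B : H -> H) (L : R) :
  (forall x y, Q x -> Q y -> 0 <= dot (B x - B y) (x - y)) ->
  (forall x y, Q x -> Q y -> `|B x - B y| <= L * `|x - y|) ->
  convex_set (vi_set dot Q B).
Proof.
move=> Bmono Blip x y t; rewrite !(vi_setE Hdot Q_convex Bmono Blip) !inE.
move=> [Qx hx] [Qy hy]; split.
  by have := Q_convex x y t (mem_set Qx) (mem_set Qy); rewrite inE.
move=> w Qw /=; have /= := hx _ Qw; have /= := hy _ Qw.
rewrite dotDr !dotZr /unstable.onem; set a := dot _ _; set b := dot _ _; set c := dot _ _.
have : 0 <= t%:num by []. have : t%:num <= 1 by [].
set s := t%:num => s1 s0 ac bc; nra.
Qed.

Section Demiclosed.
Variables (R : realType) (H : completeNormedModType R).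
Variables (dot : {dot H for (idfun : R -> R)}) (Hdot : norm_of_dot dot).
Variables (Q : set H) (Q_closed : closed Q) (Q_convex : convex_set Q).
Variables (B : H -> H) (L : R).
Hypothesis B_monotone :
  forall x y, Q x -> Q y -> 0 <= dot (B x - B y) (x - y).
Hypothesis B_lipschitz :
  forall x y, Q x -> Q y -> `|B x - B y| <= L * `|x - y|.

(** By monotonicity the hypothesis on B transfers from x n to every fixed w, as
    an approximate Minty inequality. If the conclusion failed, nested
    approximate solution sets would provide an exact solution z of the
    variational inequality with [dot v (z - q) >= delta]. *)
Lemma vi_demiclosed (x : nat -> H) (eps : nat -> R) (M : R) (v q : H) :
  (forall z, vi_set dot Q B z -> dot v (z - q) <= 0) ->
  (forall n, Q (x n)) -> (forall n, `|x n| <= M) ->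
  eps n @[n --> \oo] --> 0 ->
  (forall n w, Q w -> dot (B (x n)) (x n - w) <= eps n * (1 + `|w|)) ->
  forall delta, 0 < delta -> \forall n \near \oo, dot v (x n - q) <= delta.
Proof.
move=> vq Qx xM eps0 Bx delta delta0; apply: contrapT => frequent.
(* the ball makes the sets bounded; the error 1/(k+1) makes them nested *)
pose K k := (Q `&` closed_ball_ Num.norm 0 M) `&`
  ([set z | dot (- v) z <= - delta - dot v q] `&`
   \bigcap_(w in Q) [set z | dot (B w) z <=
                             dot (B w) w + k.+1%:R^-1 * (1 + `|w|)]).
have [z Kz] : exists z, forall k, K k z.
  apply: (nested_closed_convex Hdot (M := M)).
  - move=> k; apply: closedI.
      by apply: closedI => //; exact: closed_closed_ball_.
    apply: closedI; first exact: closed_half_space.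
    by apply: closed_bigI => w _; exact: closed_half_space.
  - move=> k; apply: midpoint_convexI.
      apply: midpoint_convexI; first exact: convex_set_midpoint.
      exact: midpoint_convex_closed_ball.
    apply: midpoint_convexI; first exact: midpoint_convex_half_space.
    by apply: midpoint_convex_bigcap => w; exact: midpoint_convex_half_space.
  - move=> k.
    have [N _ HN] : \forall n \near \oo, eps n <= k.+1%:R^-1.
      by apply: cvgr_le eps0 _ _; rewrite invr_gt0.
    have [n Nn xn] : exists2 n, (N <= n)%N & delta < dot v (x n - q).
      apply: contrapT => no; apply: frequent; exists N => // n /= Nn.
      by rewrite leNgt; apply/negP => xn; apply: no; exists n.
    exists (x n); split.
      by split; [exact: Qx|rewrite /closed_ball_ /= sub0r normrN; exact: xM].
    split=> [|w Qw] /=.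
      by move: xn; rewrite dotNl dotDr dotNr; lra.
    have := Bx n w Qw; have := B_monotone (Qx n) Qw.
    have : eps n * (1 + `|w|) <= k.+1%:R^-1 * (1 + `|w|).
      by rewrite ler_wpM2r ?addr_ge0//; exact: HN.
    rewrite !dotE; set e1 := eps n * _; set e2 := _^-1 * _.
    set p := dot (B (x n)) w; set p' := dot (B w) (x n); lra.
  - move=> k y [[Qy yM] [yv yw]]; split=> //; split=> // w Qw /=.
    apply: le_trans (yw _ Qw) _; rewrite lerD2l ler_wpM2r ?addr_ge0//.
    by rewrite lef_pV2 ?posrE// ler_nat.
  - by move=> k y [[_]]; rewrite /closed_ball_ /= sub0r normrN.
have [[Qz _] [vz _]] := Kz 0%N.
have /vq : vi_set dot Q B z.
  apply/(minty Hdot Q_convex B_monotone B_lipschitz); split => // w Qw.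
  apply/ler_addgt0Pr => e e0; rewrite add0r.
  have w1 : 0 < 1 + `|w| by rewrite ltr_pwDl.
  have [n _ /(_ n (leqnn n)) /= ne] := invS_near (divr_gt0 e0 w1).
  have [_ [_ /(_ w Qw) /=]] := Kz n.
  rewrite ler_pdivlMr// in ne.
  rewrite dotDr dotNr; set e1 := _^-1 * _ in ne *; lra.
by move: vz => /=; rewrite dotNl dotDr dotNr; lra.
Qed.

End Demiclosed.

(** * Inverse strongly monotone operators and nonexpansive mappings *)

Lemma subrACA (V : zmodType) (x y z t : V) : x - y - (z - t) = x - z - (y - t).
Proof. by rewrite !opprB addrACA [RHS]addrACA (addrC (- y)). Qed.

Section Operators.
Variables (R : realType) (H : normedModType R).
Variables (dot : {dot H for (idfun : R -> R)}) (Hdot : norm_of_dot dot).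
Variables (Q : set H).

Lemma ism_monotone (nu : R) (A : H -> H) : 0 <= nu ->
  inverse_strongly_monotone dot Q nu A ->
  forall x y, Q x -> Q y -> 0 <= dot (A x - A y) (x - y).
Proof.
by move=> nu0 ism x y Qx Qy; apply: le_trans (ism _ _ Qx Qy); rewrite mulr_ge0.
Qed.

Lemma ism_lipschitz (nu : R) (A : H -> H) : 0 < nu ->
  inverse_strongly_monotone dot Q nu A ->
  forall x y, Q x -> Q y -> `|A x - A y| <= nu^-1 * `|x - y|.
Proof.
move=> nu0 ism x y Qx Qy; have := ism _ _ Qx Qy.
have [->|Axy] := eqVneq (A x - A y) 0.
  by rewrite normr0 mulr_ge0// invr_ge0 ltW.
move=> /le_trans /(_ (dot_le_norm Hdot _ _)).
rewrite expr2 mulrCA ler_pM2l ?normr_gt0// => h.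
by rewrite mulrC ler_pdivlMr// mulrC.
Qed.

(** The displacement of a nonexpansive mapping: expand the square
    |(x - y) - (S x - S y)|^2 and bound its last term by |x - y|^2. *)
Lemma residual_ism (S : H -> H) :
  (forall x y, Q x -> Q y -> `|S x - S y| <= `|x - y|) ->
  inverse_strongly_monotone dot Q 2^-1 (fun x => x - S x).
Proof.
move=> Sne x y Qx Qy.
have : `|S x - S y| ^+ 2 <= `|x - y| ^+ 2 by rewrite ler_sqr ?nnegrE// Sne.
rewrite subrACA dotDl dotNl (dotxx Hdot) (sqnormB Hdot (x - y)).
rewrite (dotC dot (S x - S y)).
set a := `|_| ^+ 2; set b := `|_| ^+ 2; set c := dot _ _; lra.
Qed.

(** Let z solve the inequality for the sum and let p be a point of the
    intersection. Both terms of the sum at z have nonpositive products with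
    p - z, by monotonicity and because p solves both problems. These products
    add up to a nonnegative number, so they vanish. As the second one is at most
    - |z - S z|^2 / 2, it follows that S z = z. *)
Lemma fix_vi_setE (S A : H -> H) (nu : R) : 0 <= nu ->
  (forall x y, Q x -> Q y -> `|S x - S y| <= `|x - y|) ->
  inverse_strongly_monotone dot Q nu A ->
  fix_set Q S `&` vi_set dot Q A !=set0 ->
  fix_set Q S `&` vi_set dot Q A =
  vi_set dot Q (fun x => A x + (x - S x)).
Proof.
move=> nu0 Sne ism [p [[Qp Sp] [_ Ap]]]; apply/seteqP; split=> z.
  by move=> [[Qz Sz] [_ Az]]; split => // w Qw; rewrite Sz subrr addr0 Az.
move=> [Qz Bz].
suff Sz : S z = z.
  by split=> //; split=> // w Qw; have := Bz _ Qw; rewrite Sz subrr addr0.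
have := Bz _ Qp; have := ism_monotone nu0 ism Qz Qp; have := Ap _ Qz.
have := residual_ism Sne Qz Qp; rewrite Sp subrr subr0.
rewrite !(dotDl _ (A z)) (dotNl _ (A p)) -(opprB z p) !(dotNr _ _ (z - p)).
set a := dot (A p) _; set b := dot (A z) _; set c := dot (z - S z) _.
set d := `|_| ^+ 2 => h1 h2 h3 h4.
have : d = 0 by apply/eqP; rewrite eq_le sqr_ge0 andbT; lra.
by move/eqP; rewrite sqrf_eq0 normr_eq0 subr_eq0 => /eqP.
Qed.

Variables (nu : R) (A : H -> H).
Hypothesis A_ism : inverse_strongly_monotone dot Q nu A.

(** In the expansion of the square the cross term is at most
    -2 l nu |A x - A y|^2, against the last term l^2 |A x - A y|^2. *)
Lemma forward_step (x y : H) (l : R) : 0 <= l -> Q x -> Q y ->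
  `|(x - l *: A x) - (y - l *: A y)| ^+ 2 <=
  `|x - y| ^+ 2 - l * (2 * nu - l) * `|A x - A y| ^+ 2.
Proof.
move=> l0 Qx Qy; have := A_ism Qx Qy.
rewrite subrACA -scalerBr (sqnormB Hdot (x - y)) dotZr normrZ exprMn (ger0_norm l0).
rewrite (dotC dot (x - y)).
set a := `|_| ^+ 2; set b := `|_| ^+ 2; set c := dot _ _ => h.
have : l * (nu * a) <= l * c by rewrite ler_wpM2l.
lra.
Qed.

Lemma forward_nonexpansive (x y : H) (l : R) : 0 <= l <= 2 * nu -> Q x -> Q y ->
  `|(x - l *: A x) - (y - l *: A y)| <= `|x - y|.
Proof.
move=> /andP[l0 l2] Qx Qy; rewrite -ler_sqr ?nnegrE//.
apply: le_trans (forward_step l0 Qx Qy) _.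
by rewrite gerBl mulr_ge0 ?sqr_ge0// mulr_ge0// subr_ge0.
Qed.

Hypothesis Q_convex : convex_set Q.

(** Solutions of the variational inequality are the fixed points of the
    projected step. *)
Lemma vi_nearest (p : H) (l : R) : 0 <= l ->
  vi_set dot Q A p -> nearest Q (p - l *: A p) p.
Proof.
move=> l0 [Qp Ap]; apply: (nearestP Hdot) => // y Qy.
by rewrite addrAC subrr add0r dotNl dotZl oppr_le0 mulr_ge0// Ap.
Qed.

(** Both deficits are kept: the first comes from the explicit step, the second
    from the firm nonexpansiveness of the projection. Together they force
    x - y to 0 once the norms |x - p| and |y - p| agree in the limit. *)
Lemma forward_backward_decrease (x y p : H) (l : R) : 0 <= l ->
  Q x -> vi_set dot Q A p -> nearest Q (x - l *: A x) y ->
  `|y - p| ^+ 2 <= `|x - p| ^+ 2 - l * (2 * nu - l) * `|A x - A p| ^+ 2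
                   - `|x - y - l *: (A x - A p)| ^+ 2.
Proof.
move=> l0 Qx pvi ny; have Qp := pvi.1.
have := nearest_firm Hdot Q_convex ny (vi_nearest l0 pvi).
have := forward_step l0 Qx Qp; set g := x - _ - _.
have -> : x - y - l *: (A x - A p) = g - (y - p).
  have -> : g = x - p - l *: (A x - A p) by rewrite /g subrACA scalerBr.
  by rewrite [RHS]addrAC; congr (_ - _); rewrite subrACA subrr subr0.
rewrite (sqnormB Hdot g).
set a := `|g| ^+ 2; set b := dot g _; set c := `|y - p| ^+ 2.
set d := `|x - p| ^+ 2; set e := l * _ * _; lra.
Qed.

(** The obtuse angle condition at y bounds <A x, y - w>; replacing y by x costs
    the norm of x - y. *)
Lemma forward_backward_residual (x y w : H) (l a : R) : 0 < a <= l ->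
  nearest Q (x - l *: A x) y -> Q w ->
  dot (A x) (x - w) <= `|x - y| * (`|A x| + a^-1 * `|y - w|).
Proof.
move=> /andP[a0 al] ny Qw; have := nearest_obtuse Hdot Q_convex ny Qw.
have -> : x - l *: A x - y = (x - y) - l *: A x by rewrite addrAC.
have -> : x - w = (x - y) + (y - w) by rewrite addrA subrK.
rewrite -(opprB y w) dotNr oppr_le0 dotDl dotNl dotZl dotDr.
have := dot_le_norm Hdot (x - y) (y - w); have := dot_le_norm Hdot (A x) (x - y).
set b := dot (A x) (x - y); set c := dot (x - y) _; set d := dot (A x) _.
set n1 := `|A x|; set n2 := `|x - y|; set n3 := `|y - w| => h1 h2 h3.
suff : d <= a^-1 * (n2 * n3) by lra.
have n0 : 0 <= n2 * n3 by rewrite /n2 /n3 mulr_ge0.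
have [d0|d0] := leP d 0; first by apply: le_trans d0 _; rewrite mulr_ge0// invr_ge0 (ltW a0).
rewrite mulrC ler_pdivlMr//; have : d * a <= l * d by rewrite mulrC ler_wpM2r ?(ltW d0).
lra.
Qed.

End Operators.

(** * Real sequences *)

Section Sequences.
Variable R : realType.
Implicit Types (s gamma delta beta : nat -> R) (C e : R).

Lemma summable_tail beta C : (forall n, 0 <= beta n) ->
  (forall n, \sum_(0 <= k < n) beta k <= C) ->
  forall e, 0 < e -> exists N, forall n, (N <= n)%N ->
    \sum_(N <= k < n) beta k <= e.
Proof.
move=> b0 bC e e0; pose T := [set \sum_(0 <= k < n) beta k | n in setT].
have Tsup : has_sup T.
  by split; [exists (\sum_(0 <= k < 0) beta k); exists 0%N|exists C => _ [n _ <-]].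
have [_ [N _ <-] HN] := sup_adherent e0 Tsup; exists N => n Nn.
have : \sum_(0 <= k < n) beta k <= sup T.
  by apply: ub_le_sup; [exact: Tsup.2|exists n].
rewrite (big_cat_nat (leq0n N) Nn) /=; lra.
Qed.

(** From a rank N where delta is below e/3 and the tail of the sum of beta is
    also below e/3, iterate the recursion. The remaining term is s N times the
    product of the factors 1 - gamma k, and this product is at most
    1 / (1 + sum of gamma k), which tends to 0. *)
Lemma recursive_ineq_cvg0 s gamma delta beta C :
  (forall n, 0 <= s n) -> (forall n, 0 <= gamma n <= 1) ->
  (forall M, exists n, M <= \sum_(0 <= k < n) gamma k) ->
  (forall e, 0 < e -> \forall n \near \oo, delta n <= e) ->
  (forall n, 0 <= beta n) -> (forall n, \sum_(0 <= k < n) beta k <= C) ->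
  (forall n, s n.+1 <= (1 - gamma n) * s n + gamma n * delta n + beta n) ->
  s n @[n --> \oo] --> 0.
Proof.
move=> s0 g01 gdiv dle b0 bC rec; apply/cvgr0Pnorm_le => e e0.
have e3 : 0 < e / 3 by rewrite divr_gt0.
have [N1 _ HN1] := dle _ e3; have [N2 HN2] := summable_tail b0 bC e3.
pose N := maxn N1 N2.
have bN n : (N <= n)%N -> \sum_(N <= k < n) beta k <= e / 3.
  move=> Nn; apply: le_trans (HN2 n (leq_trans (leq_maxr _ _) Nn)).
  rewrite [leRHS](big_cat_nat (leq_maxr N1 N2) Nn) /= lerDr.
  by apply: sumr_ge0.
(* p is the product of the factors 1 - gamma k; multiplying it by
   1 + sum of gamma k never increases it, as (1 - g) (1 + G + g) <= 1 + G *)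
have key n : (N <= n)%N -> exists p, [/\ 0 <= p,
    p * (1 + \sum_(N <= k < n) gamma k) <= 1 &
    s n <= e / 3 + p * s N + \sum_(N <= k < n) beta k].
  move=> /subnKC <-; elim: (n - N)%N => [|m]; rewrite ?addn0 ?addnS.
    by exists 1; rewrite !big_geq// !mul1r !addr0; split; rewrite // lerDr ltW.
  set i := (N + m)%N => -[p [p0 pG sn]]; have Ni : (N <= i)%N by rewrite leq_addr.
  have /andP[g0 g1] := g01 i.
  exists ((1 - gamma i) * p); rewrite !big_nat_recr//=; split.
  - by rewrite mulr_ge0// subr_ge0.
  - apply: le_trans pG.
    have G0 : 0 <= \sum_(N <= k < i) gamma k.
      by apply: sumr_ge0 => k _; have /andP[] := g01 k.
    set G := \sum_(_ <= _ < _) _ in G0 *.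
    rewrite (mulrC (1 - _)) -mulrA; apply: ler_wpM2l => //; nra.
  - have dn : delta i <= e / 3 by apply: HN1 => /=; exact: leq_trans (leq_maxl _ _) Ni.
    have := rec i.
    have : gamma i * delta i <= gamma i * (e / 3) by rewrite ler_wpM2l.
    have : (1 - gamma i) * s i <=
      (1 - gamma i) * (e / 3 + p * s N + \sum_(N <= k < i) beta k).
      by rewrite ler_wpM2l// subr_ge0.
    have B0 : 0 <= \sum_(N <= k < i) beta k by apply: sumr_ge0.
    have : 0 <= gamma i * \sum_(N <= k < i) beta k by rewrite mulr_ge0.
    set B := \sum_(_ <= _ < _) _; lra.
have [m Hm] := gdiv (s N / (e / 3) + \sum_(0 <= k < N) gamma k).
exists (maxn N m) => // n /=; rewrite geq_max => /andP[Nn mn].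
have [p [p0 pG sn]] := key _ Nn.
rewrite ger0_norm//; apply: le_trans sn _.
have G : s N / (e / 3) <= \sum_(N <= k < n) gamma k.
  have : \sum_(0 <= k < m) gamma k <= \sum_(0 <= k < n) gamma k.
    rewrite (big_cat_nat (leq0n m) mn) /= lerDl.
    by apply: sumr_ge0 => k _; have /andP[] := g01 k.
  rewrite (big_cat_nat (leq0n N) Nn) /=; lra.
have : p * s N <= e / 3.
  rewrite ler_pdivrMr// in G.
  apply: le_trans (ler_wpM2l p0 G) _; rewrite mulrA ler_piMl ?(ltW e3)//.
  by apply: le_trans pG; rewrite ler_wpM2l// lerDr.
have := bN _ Nn; lra.
Qed.

End Sequences.

Section Hypotheses.
Variable R : realType.
Implicit Types alpha e lambda : nat -> R.

Lemma lt_limn_inf lambda (c : R) : bounded_fun lambda -> c < limn_inf lambda ->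
  exists a N, c < a /\ forall n, (N <= n)%N -> a <= lambda n.
Proof.
move=> bl; rewrite limn_infE// => /sup_gt[|_ [N _ <-] cN].
  by exists (infs lambda 0%N); exists 0%N.
exists (infs lambda N), N; split=> // n Nn; apply: ge_inf; last by exists n.
exact/has_lbound_sdrop/bounded_fun_has_lbound.
Qed.

Lemma gt_limn_sup lambda (c : R) : bounded_fun lambda -> limn_sup lambda < c ->
  exists b N, b < c /\ forall n, (N <= n)%N -> lambda n <= b.
Proof.
move=> bl; rewrite limn_supE// => /inf_lt[|_ [N _ <-] cN].
  by exists (sups lambda 0%N); exists 0%N.
exists (sups lambda N), N; split=> // n Nn; apply: ub_le_sup; last by exists n.
exact/has_ubound_sdrop/bounded_fun_has_ubound.
Qed.

Lemma nneseries_pinfty_unbounded alpha : (forall n, 0 <= alpha n) ->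
  (\sum_(0 <= n <oo) (alpha n)%:E = +oo)%E ->
  forall M, exists n, M <= \sum_(0 <= k < n) alpha k.
Proof.
move=> a0 asum M; apply: contrapT => no.
suff : (\sum_(0 <= n <oo) (alpha n)%:E <= M%:E)%E by rewrite asum.
apply: lime_le.
  by apply: is_cvg_ereal_nneg_natsum => n _; rewrite lee_fin.
apply: nearW => n; rewrite sumEFin lee_fin leNgt; apply/negP => Mn.
by apply: no; exists n; exact: ltW.
Qed.

Lemma nneseries_ltpinfty_bounded alpha : (forall n, 0 <= alpha n) ->
  (\sum_(0 <= n <oo) (alpha n)%:E < +oo)%E ->
  exists C, forall n, \sum_(0 <= k < n) alpha k <= C.
Proof.
move=> a0 asum; exists (fine (\sum_(0 <= n <oo) (alpha n)%:E)%E) => n.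
rewrite -lee_fin fineK; last first.
  by rewrite ge0_fin_numE// nneseries_ge0// => k _ _; rewrite lee_fin.
by rewrite -sumEFin; apply: nneseries_lim_ge => k _ _; rewrite lee_fin.
Qed.

Lemma sum_shift (u : nat -> R) N n :
  \sum_(N <= k < N + n) u k = \sum_(0 <= k < n) u (N + k)%N.
Proof.
by rewrite -{1}[N]add0n big_addn addKn; apply: eq_bigr => k _; rewrite addnC.
Qed.

Lemma unbounded_series_shift alpha N : (forall n, 0 <= alpha n) ->
  (forall M, exists n, M <= \sum_(0 <= k < n) alpha k) ->
  forall M, exists n, M <= \sum_(0 <= k < n) alpha (N + k)%N.
Proof.
move=> a0 adiv M; have [n Mn] := adiv (M + \sum_(0 <= k < N) alpha k).
exists n; have : \sum_(0 <= k < n) alpha k <= \sum_(0 <= k < N + n) alpha k.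
  by rewrite (big_cat_nat (leq0n n) (leq_addl N n)) /= lerDl; apply: sumr_ge0.
rewrite (big_cat_nat (leq0n N) (leq_addr n N)) /= (sum_shift alpha N n); lra.
Qed.

(** What both alternatives of the variation hypotheses have in common: the
    perturbation e splits into a part which is small compared with alpha and a
    summable part. Such a bound is exactly what [recursive_ineq_cvg0] tolerates,
    and it is stable under sums, so that the alternatives chosen for alpha and
    for lambda may differ. *)
Definition rel_negligible alpha e : Prop :=
  exists delta beta : nat -> R, exists C : R,
  [/\ forall eps, 0 < eps -> \forall n \near \oo, delta n <= eps,
      forall n, 0 <= beta n,
      forall n, \sum_(0 <= k < n) beta k <= C
    & forall n, `|e n| <= alpha n * delta n + beta n].

Lemma rel_negligibleP alpha e : (forall n, 0 < alpha n) ->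
  e n / alpha n @[n --> \oo] --> 0 \/ (\sum_(0 <= n <oo) `|e n|%:E < +oo)%E ->
  rel_negligible alpha e.
Proof.
move=> a0 [ea|es].
  exists (fun n => `|e n / alpha n|), (fun=> 0), 0; split=> //.
  - by move=> eps eps0; exact: cvgr0_norm_le.
  - by move=> n; rewrite big1.
  - move=> n; rewrite normrM normfV (ger0_norm (ltW (a0 n))) addr0 mulrC divfK//.
    by rewrite gt_eqF.
have [C eC] := nneseries_ltpinfty_bounded (fun n => normr_ge0 (e n)) es.
exists (fun=> 0), (fun n => `|e n|), C; split=> //.
- by move=> eps eps0; apply: nearW => n; exact: ltW.
- by move=> n; rewrite mulr0 add0r.
Qed.

Lemma rel_negligible_shift alpha e N : rel_negligible alpha e ->
  rel_negligible (fun n => alpha (N + n)%N) (fun n => e (N + n)%N).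
Proof.
move=> [delta [beta [C [d0 b0 bC eb]]]].
exists (fun n => delta (N + n)%N), (fun n => beta (N + n)%N), C; split=> //.
  move=> eps /d0[N' _ HN']; exists N' => // n /= Nn.
  by apply: HN'; rewrite /= (leq_trans Nn)// leq_addl.
move=> n; apply: le_trans (bC (N + n)%N).
by rewrite (big_cat_nat (leq0n N) (leq_addr n N)) /= (sum_shift beta N n) lerDr sumr_ge0.
Qed.

Lemma rel_negligible_normD alpha e1 e2 : rel_negligible alpha e1 -> rel_negligible alpha e2 ->
  rel_negligible alpha (fun n => `|e1 n| + `|e2 n|).
Proof.
move=> [d1 [b1 [C1 [d10 b10 bC1 eb1]]]] [d2 [b2 [C2 [d20 b20 bC2 eb2]]]].
exists (fun n => d1 n + d2 n), (fun n => b1 n + b2 n), (C1 + C2); split.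
- move=> eps eps0; have e2' : 0 < eps / 2 by rewrite divr_gt0.
  near=> n; rewrite [eps]splitr lerD//; near: n; [exact: d10|exact: d20].
- by move=> n; rewrite addr_ge0.
- by move=> n; rewrite big_split /= lerD.
- move=> n; rewrite ger0_norm ?addr_ge0//.
  by have := eb1 n; have := eb2 n; lra.
Unshelve. all: by end_near. Qed.

Lemma recursive_ineq_rel_negligible alpha e s (c K : R) :
  0 < c <= 1 -> 0 <= K -> (forall n, 0 < alpha n <= 1) ->
  (forall M, exists n, M <= \sum_(0 <= k < n) alpha k) ->
  rel_negligible alpha e -> (forall n, 0 <= s n) ->
  (forall n, s n.+1 <= (1 - c * alpha n) * s n + K * `|e n|) ->
  s n @[n --> \oo] --> 0.
Proof.
move=> /andP[c0 c1] K0 a01 adiv [d [b [C [d0 b0 bC eb]]]] s0 rec.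
apply: (@recursive_ineq_cvg0 _ s (fun n => c * alpha n)
  (fun n => c^-1 * K * d n) (fun n => K * b n) (K * C)) => //.
- move=> n; have /andP[a0 a1] := a01 n.
  by rewrite mulr_ge0 ?(ltW a0) ?(ltW c0)//= mulr_ile1// ltW.
- move=> M; have [n Mn] := adiv (M / c); exists n; rewrite -mulr_sumr.
  by move: Mn; rewrite ler_pdivrMr// mulrC.
- move=> eps eps0; have K1 : 0 < K + 1 by rewrite ltr_wpDl.
  have e' : 0 < c * eps / (K + 1) by rewrite divr_gt0// mulr_gt0.
  near=> n; have : d n <= c * eps / (K + 1) by near: n; exact: d0.
  rewrite ler_pdivlMr// => dn.
  rewrite -mulrA mulrC ler_pdivrMr//; have [dn0|dn0] := leP (d n) 0; nra.
- by move=> n; rewrite mulr_ge0.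
- by move=> n; rewrite -mulr_sumr ler_wpM2l.
- move=> n; apply: le_trans (rec n) _.
  have -> : c * alpha n * (c^-1 * K * d n) = K * (alpha n * d n).
    by field; rewrite gt_eqF.
  by rewrite -addrA lerD2l -mulrDr ler_wpM2l.
Unshelve. all: by end_near. Qed.

End Hypotheses.

(** * The viscosity iteration *)

Lemma cvg0_sqr (R : realType) (u : nat -> R) :
  u n ^+ 2 @[n --> \oo] --> 0 -> u n @[n --> \oo] --> 0.
Proof.
move=> u0; apply/cvgr0Pnorm_le => e e0.
near=> n; rewrite -ler_sqr ?nnegrE ?(ltW e0)// -normrX; near: n.
by apply: cvgr0_norm_le => //; rewrite exprn_gt0.
Unshelve. all: by end_near. Qed.

Lemma le_cvg0 (R : realType) (u v : nat -> R) :
  (forall n, 0 <= u n <= v n) -> v n @[n --> \oo] --> 0 ->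
  u n @[n --> \oo] --> 0.
Proof.
move=> uv v0; apply: squeeze_cvgr v0; last exact: (cvg_cst 0).
exact: nearW.
Qed.

(** Changing the weights of a convex combination; it isolates the change in the
    weights from the change in the points. *)
Lemma reweight (R : realType) (V : lmodType R) (s t : R) (u v : V) :
  t *: u + (1 - t) *: v = s *: u + (1 - s) *: v + (t - s) *: (u - v).
Proof.
rewrite scalerBr addrACA -scalerDl -scalerBl.
by congr (_ *: _ + _ *: _); ring.
Qed.

Section Iteration.
Variables (R : realType) (H : normedModType R).
Variables (dot : {dot H for (idfun : R -> R)}) (Hdot : norm_of_dot dot).
Variables (Q : set H) (Q_convex : convex_set Q).
Variables (S f A : H -> H) (nu rho a b : R).
Hypothesis SQ : forall x, Q x -> Q (S x).
Hypothesis S_nonexpansive : forall x y, Q x -> Q y -> `|S x - S y| <= `|x - y|.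
Hypothesis nu_gt0 : 0 < nu.
Hypothesis A_ism : inverse_strongly_monotone dot Q nu A.
Hypothesis rho_itv : 0 <= rho < 1.
Hypothesis fQ : forall x, Q x -> Q (f x).
Hypothesis f_contraction :
  forall x y, Q x -> Q y -> `|f x - f y| <= rho * `|x - y|.
Variables (alpha lambda : nat -> R).
Hypothesis alpha_itv : forall n, 0 < alpha n <= 1.
Hypothesis alpha_cvg0 : alpha n @[n --> \oo] --> 0.
Hypothesis alpha_div : forall M, exists n, M <= \sum_(0 <= k < n) alpha k.
Hypothesis alpha_var : rel_negligible alpha (fun n => alpha n.+1 - alpha n).
Hypothesis lambda_var : rel_negligible alpha (fun n => lambda n.+1 - lambda n).
Hypotheses (a_gt0 : 0 < a) (b_lt : b < 2 * nu).
Hypothesis lambda_itv : forall n, a <= lambda n <= b.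
Variables (q : H).
Hypotheses (q_fix : fix_set Q S q) (q_vi : vi_set dot Q A q).
Variables (x y : nat -> H).
Hypothesis x0Q : Q (x 0%N).
Hypothesis y_nearest : forall n, nearest Q (x n - lambda n *: A (x n)) (y n).
Hypothesis xS : forall n,
  x n.+1 = alpha n *: f (x n) + (1 - alpha n) *: S (y n).

Let Qq : Q q. Proof. by case: q_fix. Qed.
Let Sq : S q = q. Proof. by case: q_fix. Qed.
Let Qy n : Q (y n). Proof. by have [] := y_nearest n. Qed.

Let lambda_ge0 n : 0 <= lambda n.
Proof. by have /andP[h _] := lambda_itv n; apply: le_trans h; exact: ltW. Qed.

Let lambda_le n : lambda n <= 2 * nu.
Proof. by have /andP[_ h] := lambda_itv n; exact/(le_trans h)/ltW. Qed.

Lemma iterate_mem n : Q (x n).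
Proof.
elim: n => // n IH; rewrite xS.
have /andP[a0 a1] := alpha_itv n.
by apply: convex_set_comb => //; [exact: fQ|exact: SQ|rewrite ltW].
Qed.

Lemma forward_backward_le n : `|y n - q| <= `|x n - q|.
Proof.
apply: le_trans (nearest_nonexpansive Hdot Q_convex (y_nearest n)
  (vi_nearest Hdot (lambda_ge0 n) q_vi)) _.
apply: (forward_nonexpansive Hdot A_ism) => //; last exact: iterate_mem.
by rewrite lambda_ge0 lambda_le.
Qed.

Lemma S_forward_backward_le n : `|S (y n) - q| <= `|y n - q|.
Proof. by rewrite -{1}Sq S_nonexpansive. Qed.

(** Radius of a ball around q that contains the starting point and is invariant
    under f and under the iteration. *)
Definition radius : R := Num.max `|x 0%N - q| (`|f q - q| / (1 - rho)).

Lemma radius_ge0 : 0 <= radius.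
Proof. by rewrite le_max normr_ge0. Qed.

Lemma f_radius z : Q z -> `|z - q| <= radius -> `|f z - q| <= radius.
Proof.
move=> Qz zr; have /andP[r0 r1] := rho_itv.
have : `|f q - q| / (1 - rho) <= radius by rewrite le_max lexx orbT.
rewrite ler_pdivrMr ?subr_gt0// => fr.
have -> : f z - q = (f z - f q) + (f q - q) by rewrite addrA subrK.
apply: le_trans (ler_normD _ _) _.
have := f_contraction Qz Qq; have := ler_wpM2l r0 zr; lra.
Qed.

Lemma iterateS_sub n :
  x n.+1 - q = alpha n *: (f (x n) - q) + (1 - alpha n) *: (S (y n) - q).
Proof.
by rewrite xS !scalerBr addrACA -opprD -scalerDl addrCA subrr addr0 scale1r.
Qed.

Lemma norm_iterateS n :
  `|x n.+1 - q| <= alpha n * `|f (x n) - q| + (1 - alpha n) * `|y n - q|.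
Proof.
have /andP[a0 a1] := alpha_itv n.
rewrite iterateS_sub.
apply: le_trans (ler_normD _ _) _.
rewrite !normrZ (ger0_norm (ltW a0)) ger0_norm ?subr_ge0// lerD2l.
by rewrite ler_wpM2l ?subr_ge0// S_forward_backward_le.
Qed.

Lemma iterate_bounded n : `|x n - q| <= radius.
Proof.
elim: n => [|n IH]; first by rewrite le_max lexx.
have /andP[a0 a1] := alpha_itv n.
apply: le_trans (norm_iterateS n) _.
have fr := f_radius (iterate_mem n) IH.
have yr := le_trans (forward_backward_le n) IH.
have a1' : 0 <= 1 - alpha n by rewrite subr_ge0.
have := ler_wpM2l (ltW a0) fr; have := ler_wpM2l a1' yr; lra.
Qed.

Let f_bounded n : `|f (x n) - q| <= radius.
Proof. exact/f_radius/iterate_bounded/iterate_mem. Qed.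

Let y_bounded n : `|y n - q| <= radius.
Proof. exact: le_trans (forward_backward_le n) (iterate_bounded n). Qed.

Let fS_bounded n : `|f (x n) - S (y n)| <= 2 * radius.
Proof.
have -> : f (x n) - S (y n) = (f (x n) - q) - (S (y n) - q).
  by rewrite subrACA subrr subr0.
apply: le_trans (ler_normB _ _) _.
have := f_bounded n; have := S_forward_backward_le n; have := y_bounded n; lra.
Qed.

(** Bound for the norms of A on the ball of radius [radius] around q. *)
Definition A_radius : R := `|A q| + nu^-1 * radius.

Let A_bounded n : `|A (x n)| <= A_radius.
Proof.
have -> : A (x n) = A q + (A (x n) - A q) by rewrite addrC subrK.
apply: le_trans (ler_normD _ _) _; rewrite lerD2l.
apply: le_trans (ism_lipschitz Hdot nu_gt0 A_ism (iterate_mem n) Qq) _.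
by rewrite ler_wpM2l ?invr_ge0 ?(ltW nu_gt0)// iterate_bounded.
Qed.

Let A_radius_ge0 : 0 <= A_radius.
Proof. exact: le_trans (A_bounded 0%N). Qed.

(** The same step size is used for both points in the nonexpansive part; the
    difference of the step sizes multiplies A (x n), which is bounded. *)
Lemma forward_backward_step n :
  `|y n.+1 - y n| <=
  `|x n.+1 - x n| + `|lambda n.+1 - lambda n| * A_radius.
Proof.
apply: le_trans (nearest_nonexpansive Hdot Q_convex (y_nearest n.+1)
  (y_nearest n)) _.
set l' := lambda n.+1; set l := lambda n.
have -> : x n.+1 - l' *: A (x n.+1) - (x n - l *: A (x n)) =
  (x n.+1 - l' *: A (x n.+1) - (x n - l' *: A (x n))) - (l' - l) *: A (x n).
  rewrite -[RHS]addrA -opprD; congr (_ - _); rewrite scalerBl.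
  by rewrite addrA subrK.
apply: le_trans (ler_normB _ _) _; apply: lerD.
  apply: (forward_nonexpansive Hdot A_ism); rewrite ?lambda_ge0 ?lambda_le//;
  exact: iterate_mem.
by rewrite normrZ ler_wpM2l.
Qed.

(** The increment is expanded with the weight [alpha n] of the older step. The
    contraction factor then carries the same [alpha n] by which the variations
    of the parameters are measured, and the ratio [alpha n.+1 / alpha n], over
    which there is no control when the variations are merely summable, never
    enters. *)
Lemma iterate_step n :
  `|x n.+2 - x n.+1| <= (1 - (1 - rho) * alpha n) * `|x n.+1 - x n| +
    (2 * radius + A_radius) *
    `| `|alpha n.+1 - alpha n| + `|lambda n.+1 - lambda n| |.
Proof.
have /andP[a0 a1] := alpha_itv n; have /andP[r0 r1] := rho_itv.
have -> : x n.+2 - x n.+1 = alpha n *: (f (x n.+1) - f (x n))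
  + (1 - alpha n) *: (S (y n.+1) - S (y n))
  + (alpha n.+1 - alpha n) *: (f (x n.+1) - S (y n.+1)).
  rewrite xS (xS n) (reweight (alpha n)) addrAC opprD addrACA.
  by rewrite -!scalerBr.
rewrite (ger0_norm (addr_ge0 _ _))//.
apply: le_trans (ler_normD _ _) _.
apply: le_trans (lerD (ler_normD _ _) (lexx _)) _.
rewrite !normrZ (ger0_norm (ltW a0)) (@ger0_norm _ (1 - _)) ?subr_ge0//.
have h1 := ler_wpM2l (ltW a0) (f_contraction (iterate_mem n.+1) (iterate_mem n)).
have a1' : 0 <= 1 - alpha n by rewrite subr_ge0.
have h2 := ler_wpM2l a1' (le_trans (S_nonexpansive (Qy n.+1) (Qy n))
  (forward_backward_step n)).
have h3 := ler_wpM2l (normr_ge0 (alpha n.+1 - alpha n)) (fS_bounded n.+1).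
move: h1 h2 h3; have := radius_ge0; have := A_radius_ge0.
have := normr_ge0 (alpha n.+1 - alpha n).
have := normr_ge0 (lambda n.+1 - lambda n).
set da := `|alpha _ - _|; set dl := `|lambda _ - _|; set s := `|x _ - _|.
set u := `|f _ - f _|; set v := `|S _ - _|; set w := `|f _ - S _|.
set M := radius; set N := A_radius => dl0 da0 N0 M0 h1 h2 h3.
have k1 : 0 <= alpha n * (dl * N) by rewrite !mulr_ge0// ltW.
have k2 : 0 <= da * N by rewrite mulr_ge0.
have k3 : 0 <= dl * M by rewrite mulr_ge0.
lra.
Qed.

Lemma asymptotically_regular : `|x n.+1 - x n| @[n --> \oo] --> 0.
Proof.
have /andP[r0 r1] := rho_itv.
apply: (recursive_ineq_rel_negligible _ _ alpha_itv alpha_div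
  (rel_negligible_normD alpha_var lambda_var) _ iterate_step) => //.
  by rewrite subr_gt0 r1 gerBl.
by rewrite addr_ge0// mulr_ge0// radius_ge0.
Qed.

(** By [forward_backward_decrease] both deficits are bounded by the decrease of
    |x n - q|^2, hence by the increment and by alpha n. The vector x n - y n is
    recovered from them: |x - y| <= E + l d, where E^2 is one deficit and the
    other one, l (2 nu - l) d^2, dominates (l d)^2 up to the factor
    2 nu / (2 nu - b). *)
Lemma forward_backward_gap n :
  `|x n - y n| ^+ 2 <= (2 + 4 * nu / (2 * nu - b)) *
    (2 * radius * `|x n.+1 - x n| + 3 * radius ^+ 2 * alpha n).
Proof.
have /andP[a0 a1] := alpha_itv n; have /andP[_ lb] := lambda_itv n.
have := forward_backward_decrease Hdot A_ism Q_convex (lambda_ge0 n)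
  (iterate_mem n) q_vi (y_nearest n).
set l := lambda n; set D := A (x n) - A q.
set E := `|x n - y n - l *: D|; set d := `|D|.
have xy : `|x n - y n| <= E + l * d.
  have -> : x n - y n = (x n - y n - l *: D) + l *: D by rewrite subrK.
  by apply: le_trans (ler_normD _ _) _; rewrite normrZ (ger0_norm (lambda_ge0 n)).
have xx : `|x n - q| <= `|x n.+1 - x n| + `|x n.+1 - q|.
  have -> : x n - q = (x n.+1 - q) - (x n.+1 - x n).
    by rewrite subrACA subrr sub0r opprB.
  by apply: le_trans (ler_normB _ _) _; rewrite addrC.
have xy1 : `|x n.+1 - q| <= alpha n * radius + `|y n - q|.
  apply: le_trans (norm_iterateS n) _; apply: lerD.
    by rewrite ler_wpM2l ?(ltW a0).
  by rewrite ler_piMl// gerBl ltW.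
have := iterate_bounded n; have := iterate_bounded n.+1; have := y_bounded n.
have := normr_ge0 (x n - q); have := normr_ge0 (x n.+1 - q).
have := normr_ge0 (y n - q); have := normr_ge0 (x n.+1 - x n).
have := radius_ge0; have := lambda_ge0 n; have E0 : 0 <= E by rewrite /E.
have d0 : 0 <= d by rewrite /d.
have := normr_ge0 (x n - y n).
move: xy xx xy1; rewrite -/l.
set g := `|x n - y n|; set s := `|x n.+1 - x n|; set X := `|x n - q|.
set X' := `|x n.+1 - q|; set Y := `|y n - q|; set M := radius.
move=> xy xx xy1 g0 l0 M0 s0 Y0 X'0 X0 YM X'M XM dec.
have cb : 0 < 2 * nu - b by rewrite subr_gt0.
set P := 2 * M * s + _.
have DP : l * (2 * nu - l) * d ^+ 2 + E ^+ 2 <= P.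
  have h1 : X' ^+ 2 <= Y ^+ 2 + 3 * M ^+ 2 * alpha n.
    have : X' ^+ 2 <= (alpha n * M + Y) ^+ 2.
      by rewrite ler_sqr ?nnegrE// addr_ge0// mulr_ge0// ltW.
    have : alpha n * M * Y <= alpha n * M * M.
      by rewrite ler_wpM2l// mulr_ge0// ltW.
    have : alpha n * (alpha n * M ^+ 2) <= 1 * (alpha n * M ^+ 2).
      by rewrite ler_wpM2r// mulr_ge0 ?sqr_ge0// ltW.
    rewrite !expr2; lra.
  have h2 : X ^+ 2 - X' ^+ 2 <= 2 * M * s.
    have : (X - X') * (X + X') <= s * (X + X').
      by rewrite ler_wpM2r ?addr_ge0// lerBlDr.
    have : s * (X + X') <= s * (2 * M) by rewrite ler_wpM2l//; lra.
    rewrite !expr2; lra.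
  by rewrite /P; lra.
have lnu : l <= 2 * nu by exact: lambda_le.
have ld : (l * d) ^+ 2 <= 2 * nu / (2 * nu - b) * P.
  rewrite mulrAC ler_pdivlMr//.
  have : (l * d) ^+ 2 * (2 * nu - b) <= l * (l * (2 * nu - l) * d ^+ 2).
    rewrite exprMn !expr2.
    have : 0 <= (l * l * (d * d)) * (b - l) by rewrite !mulr_ge0// subr_ge0.
    lra.
  have : l * (l * (2 * nu - l) * d ^+ 2) <= 2 * nu * P.
    apply: ler_pM => //; first by rewrite !mulr_ge0 ?sqr_ge0// subr_ge0.
    by have := sqr_ge0 E; lra.
  lra.
have EP : E ^+ 2 <= P.
  have : 0 <= l * (2 * nu - l) * d ^+ 2 by rewrite !mulr_ge0 ?sqr_ge0// subr_ge0.
  lra.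
have : g ^+ 2 <= (E + l * d) ^+ 2 by rewrite ler_sqr ?nnegrE// addr_ge0// mulr_ge0.
have := sqr_ge0 (E - l * d); rewrite sqrrB sqrrD.
have -> : (2 + 4 * nu / (2 * nu - b)) * P = 2 * P + 2 * (2 * nu / (2 * nu - b) * P).
  by rewrite mulrDl; congr (_ + _); field; rewrite gt_eqF.
set Z := 2 * nu / _ * P in ld *; lra.
Qed.

Lemma forward_backward_cvg : `|x n - y n| @[n --> \oo] --> 0.
Proof.
apply: cvg0_sqr; apply: le_cvg0.
  by move=> n; rewrite sqr_ge0; exact: forward_backward_gap.
rewrite -[X in _ --> X](mulr0 (2 + 4 * nu / (2 * nu - b))).
apply: cvgM; first exact: cvg_cst.
rewrite -[X in _ --> X](addr0 0) -{1}(mulr0 (2 * radius)).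
rewrite -[X in _ + X](mulr0 (3 * radius ^+ 2)).
apply: cvgD; apply: cvgM => //; try exact: cvg_cst.
exact: asymptotically_regular.
Qed.

(** Compare x n with x n.+1, which differs from S (y n) by a multiple of
    [alpha n], and then S (y n) with S (x n). *)
Lemma residual_cvg : `|x n - S (x n)| @[n --> \oo] --> 0.
Proof.
apply: (@le_cvg0 _ _ (fun n => `|x n.+1 - x n| + 2 * radius * alpha n
                               + `|x n - y n|)).
  move=> n; rewrite normr_ge0 /=; have /andP[a0 a1] := alpha_itv n.
  have -> : x n - S (x n) =
      - (x n.+1 - x n) + (x n.+1 - S (y n)) - (S (x n) - S (y n)).
    by rewrite opprB addrA subrK -addrA -opprD addrCA subrr addr0.
  apply: le_trans (ler_normB _ _) _; apply: lerD; last first.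
    by apply: S_nonexpansive => //; exact: iterate_mem.
  apply: le_trans (ler_normD _ _) _; rewrite normrN lerD2l.
  have -> : x n.+1 - S (y n) = alpha n *: (f (x n) - S (y n)).
    by rewrite xS scalerBl scale1r scalerBr -addrA addrAC subrr add0r.
  by rewrite normrZ (ger0_norm (ltW a0)) mulrC ler_wpM2r ?(ltW a0).
rewrite -[X in _ --> X](addr0 0) -{1}(addr0 0).
apply: cvgD; last exact: forward_backward_cvg.
apply: cvgD; first exact: asymptotically_regular.
rewrite -[X in _ --> X](mulr0 (2 * radius)).
by apply: cvgM => //; exact: cvg_cst.
Qed.

Definition norm_radius : R := radius + `|q|.

Lemma norm_iterate_le n : `|x n| <= norm_radius.
Proof.
have -> : x n = (x n - q) + q by rewrite subrK.
by apply: le_trans (ler_normD _ _) _; rewrite lerD2r iterate_bounded.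
Qed.

Let norm_y_le n : `|y n| <= norm_radius.
Proof.
have -> : y n = (y n - q) + q by rewrite subrK.
by apply: le_trans (ler_normD _ _) _; rewrite lerD2r.
Qed.

(** Shown below to bound the defect of [x n] in the variational inequality of
    A + (I - S), per unit of 1 + |w|. *)
Definition vi_error n : R :=
  (A_radius + a^-1 * (norm_radius + 1)) * `|x n - y n| +
  (norm_radius + 1) * `|x n - S (x n)|.

Lemma vi_error_cvg : vi_error n @[n --> \oo] --> 0.
Proof.
rewrite -[X in _ --> X](addr0 0).
rewrite -{1}(mulr0 (A_radius + a^-1 * (norm_radius + 1))).
rewrite -[X in _ + X](mulr0 (norm_radius + 1)).
apply: cvgD; apply: cvgM; try exact: cvg_cst.
  exact: forward_backward_cvg.
exact: residual_cvg.
Qed.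

Lemma vi_error_le n w : Q w -> 
  dot (A (x n) + (x n - S (x n))) (x n - w) <= vi_error n * (1 + `|w|).
Proof.
move=> Qw; have /andP[al _] := lambda_itv n; rewrite dotDl.
have al' : 0 < a <= lambda n by rewrite a_gt0.
have := forward_backward_residual Hdot Q_convex al' (y_nearest n) Qw.
have := dot_le_norm Hdot (x n - S (x n)) (x n - w).
set h := dot (A _) _; set k := dot (_ - S _) _ => hk hh.
have M1 : 0 <= norm_radius by exact: le_trans (norm_iterate_le 0%N).
have bound z : `|z| <= norm_radius -> `|z - w| <= (norm_radius + 1) * (1 + `|w|).
  move=> zM; apply: le_trans (ler_normB _ _) _.
  have : 0 <= norm_radius * `|w| by rewrite mulr_ge0.
  lra.
have := bound _ (norm_iterate_le n); have := bound _ (norm_y_le n) => yw xw.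
have ai : 0 <= a^-1 by rewrite invr_ge0 ltW.
have w1 : 1 <= 1 + `|w| by rewrite lerDl.
have hA : `|A (x n)| <= A_radius * (1 + `|w|).
  by apply: le_trans (A_bounded n) _; rewrite ler_peMr.
have h1 : h <= `|x n - y n| *
    (A_radius * (1 + `|w|) + a^-1 * ((norm_radius + 1) * (1 + `|w|))).
  by apply: le_trans hh _; rewrite ler_wpM2l// lerD// ler_wpM2l.
have h2 : k <= `|x n - S (x n)| * ((norm_radius + 1) * (1 + `|w|)).
  by apply: le_trans hk _; rewrite ler_wpM2l.
by rewrite /vi_error; lra.
Qed.

Hypothesis demiclosed : forall (u : nat -> H) (eps : nat -> R) (M : R),
  (forall n, Q (u n)) -> (forall n, `|u n| <= M) ->
  eps n @[n --> \oo] --> 0 ->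
  (forall n w, Q w ->
    dot (A (u n) + (u n - S (u n))) (u n - w) <= eps n * (1 + `|w|)) ->
  forall delta, 0 < delta ->
  \forall n \near \oo, dot (f q - q) (u n - q) <= delta.

Lemma variational delta : 0 < delta ->
  \forall n \near \oo, dot (f q - q) (x n - q) <= delta.
Proof.
exact: (demiclosed iterate_mem norm_iterate_le vi_error_cvg vi_error_le).
Qed.

(** The term <f q - q, x n.+1 - q> appears when |x n.+1 - q|^2 is expanded and
    f (x n) is compared with f q. The contraction property only gives
    rho |x n - q| |x n.+1 - q|; replacing the last factor by |x n - q| plus the
    increment keeps the recursion explicit. *)
Lemma sqnorm_iterateS n :
  `|x n.+1 - q| ^+ 2 <= (1 - (1 - rho) * alpha n) * `|x n - q| ^+ 2 +
    alpha n * (radius ^+ 2 * alpha n + 2 * rho * radius * `|x n.+1 - x n| +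
               2 * dot (f q - q) (x n.+1 - q)).
Proof.
have /andP[a0 a1] := alpha_itv n; have /andP[r0 r1] := rho_itv.
have e1 : `|x n.+1 - q| ^+ 2 <= (1 - alpha n) ^+ 2 * `|x n - q| ^+ 2 +
    2 * alpha n * dot (f (x n) - q) (x n.+1 - q).
  have : `|S (y n) - q| ^+ 2 <= `|x n - q| ^+ 2.
    rewrite ler_sqr ?nnegrE//.
    exact: le_trans (S_forward_backward_le n) (forward_backward_le n).
  move=> /(ler_wpM2l (sqr_ge0 (1 - alpha n))).
  rewrite {1}iterateS_sub (sqnormD Hdot (alpha n *: _)) !normrZ !exprMn !real_normK ?num_real//.
  rewrite [in dot _ (x n.+1 - q)]iterateS_sub.
  rewrite dotDr !dotZl !dotZr (dotxx Hdot).
  have := mulr_ge0 (sqr_ge0 (alpha n)) (sqr_ge0 `|f (x n) - q|).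
  set u := `|f _ - q| ^+ 2; set v := `|S _ - q| ^+ 2; set w := `|x _ - q| ^+ 2.
  set c := dot _ _; lra.
have e2 : dot (f (x n) - q) (x n.+1 - q) <=
    rho * `|x n - q| ^+ 2 + rho * radius * `|x n.+1 - x n| +
    dot (f q - q) (x n.+1 - q).
  have -> : f (x n) - q = (f (x n) - f q) + (f q - q) by rewrite addrA subrK.
  rewrite dotDl lerD2r; apply: le_trans (dot_le_norm Hdot _ _) _.
  have h1 : `|x n.+1 - q| <= `|x n.+1 - x n| + `|x n - q|.
    by apply: le_trans (ler_normD _ _); rewrite addrA subrK.
  have h2 := f_contraction (iterate_mem n) Qq.
  apply: le_trans (ler_pM _ _ h2 h1) _ => //.
  have h3 := ler_wpM2l r0 (ler_wpM2r (normr_ge0 (x n.+1 - x n)) (iterate_bounded n)).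
  move: h3; set u := `|x n - q|; set s := `|_ - _|; lra.
have e3 : alpha n * alpha n * `|x n - q| ^+ 2 <= alpha n * alpha n * radius ^+ 2.
  rewrite ler_wpM2l ?mulr_ge0 ?(ltW a0)// ler_sqr ?nnegrE ?radius_ge0//.
  exact: iterate_bounded.
have e4 := ler_wpM2l (ltW a0) e2.
have e5 : 0 <= (1 - rho) * alpha n * `|x n - q| ^+ 2.
  by rewrite !mulr_ge0 ?sqr_ge0 ?(ltW a0)// subr_ge0 ltW.
move: e1 e3 e4 e5; rewrite [(1 - alpha n) ^+ 2]expr2.
set u := `|x n - q| ^+ 2; set u' := `|x n.+1 - q| ^+ 2.
set c := dot _ _; set c' := dot _ _; set s := `|x n.+1 - x n|; set M := radius ^+ 2.
lra.
Qed.

Lemma iterate_cvg : x n @[n --> \oo] --> q.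
Proof.
have /andP[r0 r1] := rho_itv; have r1' : 0 < 1 - rho by rewrite subr_gt0.
suff : `|x n - q| @[n --> \oo] --> 0.
  move=> h; apply/cvgrPdist_le => e e0; near=> n.
  by rewrite distrC -[leLHS]normr_id; near: n; exact: cvgr0_norm_le.
apply: cvg0_sqr.
pose del n := (radius ^+ 2 * alpha n + 2 * rho * radius * `|x n.+1 - x n| +
               2 * dot (f q - q) (x n.+1 - q)) / (1 - rho).
apply: (@recursive_ineq_cvg0 _ (fun n => `|x n - q| ^+ 2)
  (fun n => (1 - rho) * alpha n) del (fun=> 0) 0) => //.
- move=> n; have /andP[a0 a1] := alpha_itv n.
  by rewrite mulr_ge0 ?(ltW a0) ?(ltW r1')//= mulr_ile1 ?(ltW a0) ?(ltW r1')// gerBl.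
- move=> M; have [n Mn] := alpha_div (M / (1 - rho)); exists n.
  by rewrite -mulr_sumr; move: Mn; rewrite ler_pdivrMr// mulrC.
- move=> e e0; have e' : 0 < e * (1 - rho) / 4 by rewrite divr_gt0// mulr_gt0.
  have h1 : radius ^+ 2 * alpha n + 2 * rho * radius * `|x n.+1 - x n|
      @[n --> \oo] --> 0.
    rewrite -[X in _ --> X](addr0 0) -{1}(mulr0 (radius ^+ 2)).
    rewrite -[X in _ + X](mulr0 (2 * rho * radius)).
    apply: cvgD; apply: cvgM => //; try exact: cvg_cst.
    exact: asymptotically_regular.
  have [N _ HN] := variational e'.
  near=> n.
  have k1 : radius ^+ 2 * alpha n + 2 * rho * radius * `|x n.+1 - x n| <=
      e * (1 - rho) / 4.
    by near: n; apply: cvgr_le h1 _ _.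
  have k2 : dot (f q - q) (x n.+1 - q) <= e * (1 - rho) / 4.
    by apply: HN; rewrite /= ltnW// ltnS; near: n; exact: nbhs_infty_ge.
  have k3 : 0 < e * (1 - rho) by rewrite mulr_gt0.
  rewrite /del ler_pdivrMr//; lra.
- by move=> n; rewrite big1.
- move=> n; apply: le_trans (sqnorm_iterateS n) _; rewrite addr0 lerD2l.
  rewrite /del; set X := _ + 2 * _.
  have -> // : (1 - rho) * alpha n * (X / (1 - rho)) = alpha n * X.
  by field; rewrite gt_eqF.
Unshelve. all: by end_near. Qed.

End Iteration.

(** * Existence, uniqueness and convergence *)

(** The solutions are the fixed points of the projection onto Omega composed
    with f, which is a contraction of Omega. *)
Lemma exists_vp_solution (R : realType) (H : completeNormedModType R)
    (dot : {dot H for (idfun : R -> R)}) (Hdot : norm_of_dot dot)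
    (Omega : set H) (rho : R) (f : H -> H) :
  Omega !=set0 -> closed Omega -> convex_set Omega -> 0 <= rho < 1 ->
  (forall x y, Omega x -> Omega y -> `|f x - f y| <= rho * `|x - y|) ->
  exists q, unique (vp_solution dot Omega f) q.
Proof.
move=> O0 Ocl Ocv /andP[r0 r1] fcon.
pose g x := metric_proj Omega (f x).
have gP x : nearest Omega (f x) (g x) by exact: metric_projP.
have gO : set_fun Omega Omega g by move=> x _; have [] := gP x.
have gcon : is_contraction (mkfun_fun gO).
  exists (NngNum r0); split=> // -[x y] [/= Ox Oy].
  apply: le_trans (fcon _ _ Ox Oy).
  exact: (nearest_nonexpansive Hdot Ocv (gP x) (gP y)).
have [q Oq /= qE] := banach_fixed_point gcon Ocl O0.
have nq : nearest Omega (f q) q by rewrite {2}qE.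
exists q; split.
  by split=> // x Ox; exact: (nearest_obtuse Hdot Ocv nq Ox).
move=> q' [Oq' vq']; have nq' := nearestP Hdot Oq' vq'.
have := le_trans (nearest_nonexpansive Hdot Ocv nq nq') (fcon _ _ Oq Oq').
have [/subr0_eq->//|qq'] := eqVneq (q - q') 0.
rewrite -subr_ge0 -{2}[`|_|]mul1r -mulrBl pmulr_lge0 ?normr_gt0// subr_ge0.
by rewrite leNgt r1.
Qed.

Theorem theorem4p1 (R : realType) (H : completeNormedModType R)
    (dot : {dot H for (idfun : R -> R)}) (Hdot : norm_of_dot dot)
    (Q : set H) (Q_neq0 : Q !=set0) (Q_closed : closed Q)
    (Q_convex : convex_set Q)
    (S : {fun Q >-> Q}) (S_nonexpansive : 1.-lipschitz_Q S)
    (nu : R) (nu_gt0 : 0 < nu)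
    (A : H -> H) (A_ism : inverse_strongly_monotone dot Q nu A)
    (rho : R) (rho_itv : 0 <= rho < 1)
    (f : {fun Q >-> Q}) (f_contraction : rho.-lipschitz_Q f)
    (Omega_neq0 : fix_set Q S `&` vi_set dot Q A !=set0)
    (alpha lambda : nat -> R)
    (alpha_itv : forall n, 0 < alpha n <= 1)
    (lambda_itv : forall n, 0 <= lambda n <= 2 * nu)
    (alpha_cvg0 : alpha n @[n --> \oo] --> 0)
    (alpha_sum : (\sum_(0 <= n <oo) (alpha n)%:E = +oo)%E)
    (lambda_lim : [/\ 0 < limn_inf lambda,
                      limn_inf lambda <= limn_sup lambda
                    & limn_sup lambda < 2 * nu])
    (alpha_var :
      (alpha n.+1 - alpha n) / alpha n @[n --> \oo] --> 0 \/
      (\sum_(0 <= n <oo) `|alpha n.+1 - alpha n|%:E < +oo)%E)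
    (lambda_var :
      (lambda n.+1 - lambda n) / alpha n @[n --> \oo] --> 0 \/
      (\sum_(0 <= n <oo) `|lambda n.+1 - lambda n|%:E < +oo)%E) :
  exists q : H,
    unique (vp_solution dot (fix_set Q S `&` vi_set dot Q A) f) q /\
    forall x : nat -> H, Q (x 1%N) ->
      (forall n, (1 <= n)%N ->
        x n.+1 = alpha n *: f (x n)
          + (1 - alpha n) *: S (metric_proj Q (x n - lambda n *: A (x n)))) ->
      x n @[n --> \oo] --> q.
Proof.
have [r0 r1] := andP rho_itv.
have Sne x y : Q x -> Q y -> `|S x - S y| <= `|x - y|.
  by move=> Qx Qy; have := S_nonexpansive (x, y) (conj Qx Qy); rewrite /= mul1r.
have fcon x y : Q x -> Q y -> `|f x - f y| <= rho * `|x - y|.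
  by move=> Qx Qy; exact: (f_contraction (x, y) (conj Qx Qy)).
have SQ x : Q x -> Q (S x) by exact: funS.
have fQ x : Q x -> Q (f x) by exact: funS.
pose B x := A x + (x - S x); pose L := nu^-1 + (2^-1)^-1.
have res_ism := residual_ism Hdot Sne.
have half_gt0 : 0 < 2^-1 :> R by [].
have B_monotone x y : Q x -> Q y -> 0 <= dot (B x - B y) (x - y).
  move=> Qx Qy; rewrite /B opprD addrACA dotDl addr_ge0//.
    exact: (ism_monotone (ltW nu_gt0) A_ism).
  exact: (ism_monotone (ltW half_gt0) res_ism).
have B_lipschitz x y : Q x -> Q y -> `|B x - B y| <= L * `|x - y|.
  move=> Qx Qy; rewrite /B opprD addrACA mulrDl.
  apply: le_trans (ler_normD _ _) _; apply: lerD.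
    exact: (ism_lipschitz Hdot nu_gt0 A_ism).
  exact: (ism_lipschitz Hdot half_gt0 res_ism).
set Omega := fix_set Q S `&` vi_set dot Q A.
have OmegaE : Omega = vi_set dot Q B.
  exact: (fix_vi_setE Hdot (ltW nu_gt0)).
have Omega_closed : closed Omega.
  rewrite OmegaE; exact: (closed_vi_set Hdot Q_convex B_monotone B_lipschitz).
have Omega_convex : convex_set Omega.
  rewrite OmegaE; exact: (convex_vi_set Hdot Q_convex B_monotone B_lipschitz).
have OmegaQ x : Omega x -> Q x by case=> -[].
have [q qU] : exists q, unique (vp_solution dot Omega f) q.
  apply: (exists_vp_solution Hdot Omega_neq0 Omega_closed Omega_convex rho_itv).
  by move=> x y /OmegaQ Qx /OmegaQ Qy; exact: fcon.
exists q; split=> // x x1Q xS; have [[Oq vq] _] := qU.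
have lambda_bounded : bounded_fun lambda.
  exists (2 * nu); split; first exact: num_real.
  move=> M nuM n _ /=; have /andP[l0 l1] := lambda_itv n.
  by rewrite ger0_norm// (le_trans l1)// ltW.
have [linf _ lsup] := lambda_lim.
have [a [N1 [a0 aN]]] := lt_limn_inf lambda_bounded linf.
have [b [N2 [bnu bN]]] := gt_limn_sup lambda_bounded lsup.
(* from the rank N on, the step sizes stay in the interval [a, b]; the index 1
   is the one from which the iteration is defined *)
pose N := maxn 1 (maxn N1 N2).
have N0 n : (0 < N + n)%N.
  by apply: leq_trans (leq_addr _ _); rewrite leq_maxl.
have lambda_tail n : a <= lambda (N + n)%N <= b.
  apply/andP; split; [apply: aN|apply: bN]; apply: leq_trans (leq_addr _ _).
    by rewrite leq_max leq_max leqnn orbT.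
  by rewrite leq_max leq_max leqnn !orbT.
have projP z : nearest Q z (metric_proj Q z) by exact: metric_projP.
have xQ n : (0 < n)%N -> Q (x n).
  elim: n => // -[_ _//|n IH _]; have Qx := IH isT.
  have /andP[/ltW al0 al1] := alpha_itv n.+1.
  rewrite xS//; apply: convex_set_comb => //; [exact: fQ| |by rewrite al0].
  exact/SQ/(projP _).1.
have shifted_var (u : nat -> R) :
    (u n.+1 - u n) / alpha n @[n --> \oo] --> 0 \/
    (\sum_(0 <= n <oo) `|u n.+1 - u n|%:E < +oo)%E ->
    rel_negligible (fun n => alpha (N + n)%N)
      (fun n => u (N + n.+1)%N - u (N + n)%N).
  move=> /(rel_negligibleP (fun n => (andP (alpha_itv n)).1)).
  move=> /(rel_negligible_shift N).
  suff -> : (fun n => u (N + n.+1)%N - u (N + n)%N) =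
            (fun n => u (N + n).+1 - u (N + n)%N) by [].
  by apply/funext => n; rewrite addnS.
rewrite -(cvg_shiftn N) /=.
under eq_fun do rewrite addnC.
pose y n := metric_proj Q (x (N + n)%N - lambda (N + n)%N *: A (x (N + n)%N)).
apply: (@iterate_cvg R H dot Hdot Q Q_convex S f A nu rho a b SQ Sne nu_gt0 A_ism
  rho_itv fQ fcon (fun n => alpha (N + n)%N) (fun n => lambda (N + n)%N)
  _ _ _ _ _ a0 bnu lambda_tail q Oq.1 Oq.2 (fun n => x (N + n)%N) y).
- by move=> n; exact: alpha_itv.
- by move: alpha_cvg0; rewrite -(cvg_shiftn N) /=; under eq_fun do rewrite addnC.
- apply: unbounded_series_shift; first by move=> n; have /andP[/ltW] := alpha_itv n.
  by apply: nneseries_pinfty_unbounded => // n; have /andP[/ltW] := alpha_itv n.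
- exact: shifted_var alpha_var.
- exact: shifted_var lambda_var.
- exact: xQ.
- by move=> n; exact: projP.
- by move=> n; rewrite addnS xS.
- move=> u eps M uQ uM eps0 Bu.
  apply: (vi_demiclosed Hdot Q_closed Q_convex B_monotone B_lipschitz _ uQ uM
    eps0 Bu).
  by rewrite -OmegaE.
Qed.
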